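(* Let $\mathbb{K}$ be a field and let $\mathcal{G}$ be a second-countable ample groupoid such that $\mathcal{G}^{(0)}$ is Hausdorff. Then $A_{\mathbb{K}}(\mathcal{G})$ is simple if and only if the following three conditions are satisfied: (1) $\mathcal{G}$ is minimal; (2) $\mathcal{G}$ is effective; and (3) for every nonzero $f\in A_{\mathbb{K}}(\mathcal{G})$, $\operatorname{supp}(f)$ has nonempty interior in $\mathcal{G}$.
   Context: All groupoids are topological groupoids $\mathcal{G}$ with unit space $\mathcal{G}^{(0)}$ and range and source maps $r,s$; they are locally compact but not necessarily Hausdorff, and ''compact'' does not presuppose Hausdorff. An open bisection is an open set $B\subseteq\mathcal{G}$ such that $r$ and $s$ each restrict to a homeomorphism of $B$ onto an open subset of $\mathcal{G}^{(0)}$. $\mathcal{G}$ is étale if its topology has a basis of open bisections, and ample if its topology has a basis of compact open bisections. The isotropy bundle is $\operatorname{Iso}(\mathcal{G})=\{\gamma\in\mathcal{G}: r(\gamma)=s(\gamma)\}$; $\mathcal{G}$ is effective if the interior of $\operatorname{Iso}(\mathcal{G})$ equals $\mathcal{G}^{(0)}$. $\mathcal{G}$ is minimal if for every $u\in\mathcal{G}^{(0)}$ the orbit $[u]=s(r^{-1}(u))$ is dense in $\mathcal{G}^{(0)}$. For an ample groupoid with Hausdorff unit space, the Steinberg algebra $A_{\mathbb{K}}(\mathcal{G})$ is the $\mathbb{K}$-linear span of the characteristic functions $1_B:\mathcal{G}\to\mathbb{K}$ of compact open bisections $B$, with pointwise addition and scalar multiplication and convolution product $f*g(\gamma)=\sum_{r(\eta)=r(\gamma)}f(\eta)g(\eta^{-1}\gamma)$.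 It is simple if its only two-sided ideals are $0$ and itself. For a function $f$ on $\mathcal{G}$, $\operatorname{supp}(f)=\{\gamma: f(\gamma)\neq 0\}$ (no closure is taken). *)

(* Defs.v *)
From HB Require Import structures.
From mathcomp Require Import all_boot all_order all_algebra.
From mathcomp Require Import all_classical all_reals all_analysis.

Set Implicit Arguments.
Unset Strict Implicit.
Unset Printing Implicit Defensive.
Import GRing.Theory.

Local Open Scope classical_set_scope.
Local Open Scope ring_scope.

(* Groupoids are small categories in which every arrow is invertible, presented
   by their set of arrows; an object is identified with its identity arrow.
   The product is a total function whose values are only meaningful on pairs
   (g, h) with [gsrc g = grng h]. *)
HB.mixin Record isGroupoid G := {
  grng : G -> G;
  gsrc : G -> G;
  gmul : G -> G -> G;
  ginv : G -> G;
  grng_grng : forall g, grng (grng g) = grng g;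
  grng_gsrc : forall g, grng (gsrc g) = gsrc g;
  gsrc_grng : forall g, gsrc (grng g) = grng g;
  gsrc_gsrc : forall g, gsrc (gsrc g) = gsrc g;
  grng_gmul : forall g h, gsrc g = grng h -> grng (gmul g h) = grng g;
  gsrc_gmul : forall g h, gsrc g = grng h -> gsrc (gmul g h) = gsrc h;
  gmulA : forall g h k, gsrc g = grng h -> gsrc h = grng k ->
    gmul g (gmul h k) = gmul (gmul g h) k;
  gmul_grng : forall g, gmul (grng g) g = g;
  gmul_gsrc : forall g, gmul g (gsrc g) = g;
  grng_ginv : forall g, grng (ginv g) = gsrc g;
  gsrc_ginv : forall g, gsrc (ginv g) = grng g;
  gmulVg : forall g, gmul (ginv g) g = gsrc g;
  gmulgV : forall g, gmul g (ginv g) = grng g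
}.

#[short(type="groupoidType")]
HB.structure Definition Groupoid := {G of isGroupoid G}.

HB.mixin Record Groupoid_isTopological G & Groupoid G & Topological G := {
  gmul_continuous :
    {within [set p : G * G | gsrc p.1 = grng p.2],
      continuous (fun p : G * G => gmul p.1 p.2)};
  ginv_continuous : continuous (@ginv G)
}.

(* Continuity of [grng] and [gsrc] follows: [grng g = gmul g (ginv g)]. *)
#[short(type="topGroupoidType")]
HB.structure Definition TopGroupoid :=
  {G of Groupoid G & Topological G & Groupoid_isTopological G}.

Definition units (G : groupoidType) : set G := [set x | grng x = x].
Arguments units G : clear implicits.

Definition Iso (G : groupoidType) : set G := [set g | grng g = gsrc g].
Arguments Iso G : clear implicits.

Definition orbit (G : groupoidType) (u : G) : set G :=
  gsrc @` [set g | grng g = u].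

Definition homeo_onto (X Y : topologicalType) (A : set X) (B : set Y)
    (f : X -> Y) :=
  exists g : Y -> X, [/\ f @` A = B, {in A, cancel f g},
    {within A, continuous f} & {within B, continuous g}].

(* Relative topology of the unit space: [units G] coerces to the subtype
   [set_type (units G)], which carries the topology induced from [G]. *)
Definition open_in_units (G : topGroupoidType) (A : set G) :=
  A `<=` units G /\ open (set_val @^-1` A : set (units G)).

Definition dense_in_units (G : topGroupoidType) (A : set G) :=
  A `<=` units G /\ dense (set_val @^-1` A : set (units G)).

Definition open_bisection (G : topGroupoidType) (B : set G) :=
  [/\ open B,
      open_in_units (grng @` B) /\ homeo_onto B (grng @` B) grng &
      open_in_units (gsrc @` B) /\ homeo_onto B (gsrc @` B) gsrc].

Definition compact_open_bisection (G : topGroupoidType) (B : set G) :=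
  open_bisection B /\ compact B.

(* No local compactness is required separately: an ample groupoid has a basis
   of compact open sets. (The library's [locally_compact] asks for closed
   compact neighbourhoods, which is too strong for non-Hausdorff spaces.) *)
Definition ample (G : topGroupoidType) :=
  exists2 B : set (set G), basis B & B `<=` @compact_open_bisection G.

Definition effective (G : topGroupoidType) := (Iso G)^° = units G.

Definition minimal (G : topGroupoidType) :=
  forall u : G, units G u -> dense_in_units (orbit u).

Section SteinbergAlgebra.
Variables (K : fieldType) (G : topGroupoidType).

Definition steinberg : set (G -> K) :=
  [set f | exists n (c : 'I_n -> K) (B : 'I_n -> set G),
    (forall i, compact_open_bisection (B i)) /\
    f = (fun g => \sum_(i < n) c i * \1_(B i) g)].

(* The index set may be infinite, but for [f] in [steinberg] only finitely many
   summands are nonzero, since [grng] is injective on bisections. *)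
Definition conv (f g : G -> K) : G -> K :=
  fun x => \sum_(y \in [set y | grng y = grng x]) f y * g (gmul (ginv y) x).

Definition two_sided_ideal (I : set (G -> K)) :=
  [/\ I `<=` steinberg,
      I (fun=> 0),
      (forall f g, I f -> I g -> I (fun x => f x + g x)),
      (forall (c : K) f, I f -> I (fun x => c * f x)) &
      (forall f g, steinberg f -> I g -> I (conv f g) /\ I (conv g f))].

Definition steinberg_simple :=
  forall I, two_sided_ideal I -> I = [set (fun=> 0)] \/ I = steinberg.

Definition supp (f : G -> K) : set G := [set x | f x != 0].

End SteinbergAlgebra.

(* Main.v *)
(**
Each of the three conditions, when it fails, yields a nonzero proper ideal. If the
orbit of [u] is not dense, take the functions vanishing on the arrows with
source in that orbit. If some nonzero function has a support with empty
interior, take the functions vanishing on a dense open set. If the interior of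
the isotropy contains a compact open bisection [B] with a non-unit, take the
functions whose sums over all sets [r^-1(v) `&` s^-1(u)] vanish, i.e. the kernel
of the action on the free module on the units; it contains [1_B - 1_(s B)].

Conversely, let [I] be an ideal containing [f <> 0]. As [supp f] has nonempty
interior, a translate of [f] by a bisection is nonzero on a nonempty open set of
units. Since the groupoid is effective, a smaller compact open set [W] of units
can be chosen such that each of the finitely many bisections defining the
translate either contains [W] or has no arrow from [W] to [W]; compressing the
translate to [W] then gives a nonzero multiple of [1_W], so [1_W] is in [I]. By
minimality, conjugates of [1_W] are indicators of neighbourhoods of any given
unit, and compactness gives [1_B] in [I] for all compact open bisections [B].
*)
Require Import Defs.
From HB Require Import structures.
From mathcomp Require Import all_boot all_order all_algebra finmap.
From mathcomp Require Import all_classical all_reals all_analysis.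

Set Implicit Arguments.
Unset Strict Implicit.
Unset Printing Implicit Defensive.
Import GRing.Theory.

Local Open Scope classical_set_scope.
Local Open Scope ring_scope.

(* [convex.conv] and [fingraph.orbit] shadow the definitions of [Defs]. *)
Local Notation conv := Defs.conv.
Local Notation orbit := Defs.orbit.

(** * Groupoids and ample topology *)

Section GroupoidAlgebra.
Variable G : groupoidType.
Implicit Types (g h k u : G) (A B : set G).

Lemma gmulKg g h : gsrc g = grng h -> gmul (ginv g) (gmul g h) = h.
Proof.
by move=> gh; rewrite gmulA ?gsrc_ginv// gmulVg gh gmul_grng.
Qed.

Lemma gmulVKg g h : grng g = grng h -> gmul g (gmul (ginv g) h) = h.
Proof.
by move=> gh; rewrite gmulA ?grng_ginv ?gsrc_ginv// gmulgV gh gmul_grng.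
Qed.

Lemma gmulgK g h : gsrc g = grng h -> gmul (gmul g h) (ginv h) = g.
Proof.
by move=> gh; rewrite -gmulA ?grng_ginv// gmulgV -gh gmul_gsrc.
Qed.

Lemma gmulgKV g h : gsrc g = gsrc h -> gmul (gmul g (ginv h)) h = g.
Proof.
by move=> gh; rewrite -gmulA ?grng_ginv ?gsrc_ginv// gmulVg -gh gmul_gsrc.
Qed.

Lemma ginvK g : ginv (ginv g) = g.
Proof.
have := @gmulgKV (ginv (ginv g)) g.
by rewrite gsrc_ginv grng_ginv gmulVg gsrc_ginv -(grng_ginv g) gmul_grng => <-.
Qed.

Lemma unit_gsrc u : units G u -> gsrc u = u.
Proof. by move=> <-; rewrite gsrc_grng. Qed.

Lemma units_grng g : units G (grng g).
Proof. exact: grng_grng. Qed.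

Lemma units_gsrc g : units G (gsrc g).
Proof. exact: grng_gsrc. Qed.

Lemma ginv_unit u : units G u -> ginv u = u.
Proof.
move=> uu; rewrite -[LHS]gmul_gsrc gsrc_ginv uu gmulVg; exact: unit_gsrc.
Qed.

Definition setgmul A B : set G :=
  [set g | exists a b, [/\ A a, B b, gsrc a = grng b & g = gmul a b]].

Definition rng_inj A := forall a b, A a -> A b -> grng a = grng b -> a = b.
Definition src_inj A := forall a b, A a -> A b -> gsrc a = gsrc b -> a = b.

Lemma setgmul_rng_inj A B : rng_inj A -> rng_inj B -> rng_inj (setgmul A B).
Proof.
move=> iA iB _ _ [a [b [Aa Bb ab ->]]] [c [d [Ac Bd cd ->]]].
rewrite !grng_gmul// => /(iA _ _ Aa Ac) ac.
by rewrite ac in ab *; rewrite (iB b d)// -ab.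
Qed.

Lemma setgmul_src_inj A B : src_inj A -> src_inj B -> src_inj (setgmul A B).
Proof.
move=> iA iB _ _ [a [b [Aa Bb ab ->]]] [c [d [Ac Bd cd ->]]].
rewrite !gsrc_gmul// => /(iB _ _ Bb Bd) bd.
by rewrite bd in ab *; rewrite (iA a c)// ab.
Qed.

Lemma ginv_src_inj A : rng_inj A -> src_inj (@ginv G @^-1` A).
Proof.
move=> iA a b Aa Ab; rewrite -!grng_ginv => /(iA _ _ Aa Ab) ab.
by rewrite -[a]ginvK ab ginvK.
Qed.

Lemma ginv_rng_inj A : src_inj A -> rng_inj (@ginv G @^-1` A).
Proof.
move=> iA a b Aa Ab; rewrite -!gsrc_ginv => /(iA _ _ Aa Ab) ab.
by rewrite -[a]ginvK ab ginvK.
Qed.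

Lemma image_ginv A : @ginv G @` A = @ginv G @^-1` A.
Proof.
apply/seteqP; split=> x /=; first by move=> [a Aa <-]; rewrite ginvK.
by move=> Ax; exists (ginv x); rewrite ?ginvK.
Qed.

End GroupoidAlgebra.

(** * Range and source maps, bisections and their products in an ample groupoid *)

Section GroupoidTopology.
Variable G : topGroupoidType.
Implicit Types (g h k u : G) (A B U V : set G).

(** The product is continuous only on composable pairs, so the two families must be composable
    eventually along [F]. In this form limits of products can be taken without returning to the
    subspace topology. *)
Lemma gmul_cvg T (F : set_system T) (a b : T -> G) g h :
    Filter F -> gsrc g = grng h -> a @ F --> g -> b @ F --> h ->
    (\forall x \near F, gsrc (a x) = grng (b x)) ->
  gmul (a x) (b x) @[x --> F] --> gmul g h.
Proof.
move=> FF gh ag bh ab.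
have /subspace_continuousP/(_ (g, h) gh) c := @gmul_continuous G.
apply: (cvg_comp (fun x => (a x, b x)) _ _ c).
move=> P; rewrite /within /nbhs /= => Pw.
have /(_ _ _ _ _ Pw) := cvg_pair (f := a) (g := b) ag bh.
by apply: filterS2 ab => x abx; exact.
Qed.

Lemma grng_continuous : continuous (@grng G).
Proof.
move=> g; rewrite /continuous_at -(gmulgV g).
rewrite (_ : @grng G = fun x => gmul x (ginv x)); last first.
  by apply/funext => x; rewrite gmulgV.
apply: gmul_cvg => //; [by rewrite grng_ginv|exact: ginv_continuous|].
by apply: nearW => x; rewrite grng_ginv.
Qed.

Lemma gsrc_continuous : continuous (@gsrc G).
Proof.
move=> g; rewrite (_ : @gsrc G = @grng G \o @ginv G); last first.
  by apply/funext => x /=; rewrite grng_ginv.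
apply: continuous_comp; [exact: ginv_continuous|exact: grng_continuous].
Qed.

(** Hausdorffness and relative openness live on the subtype [units G]; preimages under this
    corestricted range map carry them back to [G]. *)
Definition unit_rng g : units G := SigSub (mem_set (units_grng g)).

Lemma val_unit_rng g : set_val (unit_rng g) = grng g.
Proof. by []. Qed.

Lemma unit_rng_continuous : continuous unit_rng.
Proof. by apply: continuous_comp_initial => g; exact: grng_continuous. Qed.

Lemma open_ginv_preimage U : open U -> open (@ginv G @^-1` U).
Proof. by move=> oU; apply: open_comp => // x _; exact: ginv_continuous. Qed.

Lemma open_rng_preimage U : open U -> open (@grng G @^-1` U).
Proof. by move=> oU; apply: open_comp => // x _; exact: grng_continuous. Qed.

Lemma open_src_preimage U : open U -> open (@gsrc G @^-1` U).
Proof. by move=> oU; apply: open_comp => // x _; exact: gsrc_continuous. Qed.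

Lemma open_unit_rng_preimage (W : set (units G)) :
  open W -> open (unit_rng @^-1` W).
Proof.
by move=> oW; apply: open_comp => // x _; exact: unit_rng_continuous.
Qed.

Lemma cvg_ginv_gmul T (F : set_system T) (a b : T -> G) g h :
    Filter F -> grng g = grng h -> a @ F --> g -> b @ F --> h ->
    (\forall x \near F, grng (a x) = grng (b x)) ->
  gmul (ginv (a x)) (b x) @[x --> F] --> gmul (ginv g) h.
Proof.
move=> FF gh ag bh ab; apply: gmul_cvg => //; first by rewrite gsrc_ginv.
- by apply: cvg_comp ag _; exact: ginv_continuous.
- by apply: filterS ab => x; rewrite gsrc_ginv.
Qed.

Lemma open_bisection_inj B : open_bisection B -> rng_inj B /\ src_inj B.
Proof.
move=> [oB [_ [f [_ fK _ _]]] [_ [h [_ hK _ _]]]].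
split=> a b Ba Bb ab.
  by rewrite -[a]fK ?inE// ab fK ?inE.
by rewrite -[a]hK ?inE// ab hK ?inE.
Qed.

(** Working form of [compact_open_bisection]: the homeomorphism conditions reduce to injectivity
    once range and source are known to be open maps. *)
Definition compact_bisection B := [/\ open B, compact B, rng_inj B & src_inj B].

Hypothesis hample : ample G.

Lemma ample_nbhs g U : open U -> U g ->
  exists B, [/\ compact_open_bisection B, B g & B `<=` U].
Proof.
case: hample => BB [_ Bb] Bc oU Ug.
have [B [BB_B Bg] BU] := Bb g _ (open_nbhs_nbhs (conj oU Ug)).
by exists B; split=> //; exact: Bc.
Qed.

(** Let [B] be a bisection around the unit [u]. For [b] near [u], both [b] and [gsrc b] lie in [B];
    they have the same source, so [b = gsrc b]. *)
Lemma open_units : open (units G).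
Proof.
rewrite openE => u uu.
have [B [[oB _] Bu _]] := ample_nbhs openT (I : setT u).
have [_ iB] := open_bisection_inj oB; have {}oB : open B by case: oB.
rewrite /interior.
have BS : nbhs u (B `&` @gsrc G @^-1` B).
  apply: open_nbhs_nbhs; split; last by split=> //=; rewrite (unit_gsrc uu).
  by apply: openI => //; exact: open_src_preimage.
apply: filterS BS => b [Bb Bsb]; rewrite /units/=.
by rewrite [b](iB b (gsrc b))// ?grng_gsrc ?gsrc_gsrc.
Qed.

(** The range of a basic bisection is relatively open in the units, and the units are open in
    [G]. *)
Lemma open_rng_image U : open U -> open (@grng G @` U).
Proof.
move=> oU; rewrite openE => _ [g Ug <-].
have [B [[[oB [[_ orB] _] _] _] Bg BU]] := ample_nbhs oU Ug.
suff : nbhs (grng g) (@grng G @` B).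
  by apply: filterS => _ [b Bb <-]; exists b => //; exact: BU.
have : nbhs (grng g) (unit_rng @^-1` (set_val @^-1` (@grng G @` B))).
  apply: open_nbhs_nbhs; split; last first.
    by rewrite /preimage/= val_unit_rng grng_grng; exists g.
  by exact: open_unit_rng_preimage.
have : nbhs (grng g) (units G).
  by apply: open_nbhs_nbhs; split; [exact: open_units|exact: units_grng].
by apply: filterS2 => x /= xu [b Bb]; rewrite val_unit_rng xu => <-; exists b.
Qed.

Lemma open_src_image U : open U -> open (@gsrc G @` U).
Proof.
move=> oU; rewrite (_ : _ @` U = @grng G @` (@ginv G @^-1` U)).
  by apply: open_rng_image; exact: open_ginv_preimage.
rewrite -image_ginv image_comp; congr image.
by apply/funext => x /=; rewrite grng_ginv.
Qed.

Lemma open_in_unitsP U : open U -> U `<=` units G -> open_in_units U.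
Proof.
move=> oU UG; split=> //; apply: open_comp => // x _.
exact: initial_continuous.
Qed.

Lemma inj_open_homeo B (f : G -> G) :
    open B -> (forall a b, B a -> B b -> f a = f b -> a = b) -> continuous f ->
    (forall U, open U -> open (f @` U)) -> homeo_onto B (f @` B) f.
Proof.
move=> oB iB cf fo.
pose h y := xget y [set b | B b /\ f b = y].
have hP b : B b -> h (f b) = b.
  by move=> Bb; rewrite /h; case: xgetP => [x -> [Bx /iB ->//]|/(_ b)[]].
exists h; split=> //; first by move=> b /set_mem /hP.
  exact: continuous_subspaceT.
rewrite continuous_open_subspace; last exact: fo.
move=> _ /set_mem[b Bb <-] N; rewrite hP// nbhsE => -[U [oU Ub] UN].
rewrite /= nbhs_simpl.
have : nbhs (f b) (f @` (B `&` U)).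
  by apply: open_nbhs_nbhs; split; [apply: fo; exact: openI|exists b].
by apply: filterS => _ [c [Bc Uc] <-]; rewrite /= hP//; exact: UN.
Qed.

Lemma compact_open_bisectionP B :
  compact_open_bisection B <-> compact_bisection B.
Proof.
split=> [[oB cB]|[oB cB rB sB]].
  by have [? ?] := open_bisection_inj oB; split=> //; case: oB.
split=> //; split=> //; split.
- apply: open_in_unitsP; first exact: open_rng_image.
  by move=> _ [b _ <-]; exact: units_grng.
- apply: inj_open_homeo => //; [exact: grng_continuous|exact: open_rng_image].
- apply: open_in_unitsP; first exact: open_src_image.
  by move=> _ [b _ <-]; exact: units_gsrc.
- apply: inj_open_homeo => //; [exact: gsrc_continuous|exact: open_src_image].
Qed.

Lemma compact_bisection_nbhs g U : open U -> U g ->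
  exists B, [/\ compact_bisection B, B g & B `<=` U].
Proof.
move=> oU /(ample_nbhs oU)[B [/compact_open_bisectionP ? ? ?]].
by exists B.
Qed.

Lemma compact_bisectionV B :
  compact_bisection B -> compact_bisection (@ginv G @^-1` B).
Proof.
move=> [oB cB rB sB]; split.
- by exact: open_ginv_preimage.
- rewrite -image_ginv; apply: continuous_compact => //.
  by apply: continuous_subspaceT; exact: ginv_continuous.
- exact: ginv_rng_inj.
- exact: ginv_src_inj.
Qed.

Lemma unit_rng_inj U : U `<=` units G -> rng_inj U.
Proof. by move=> UG a b /UG + /UG; rewrite /units/= => -> ->. Qed.

Lemma unit_src_inj U : U `<=` units G -> src_inj U.
Proof. by move=> UG a b /UG/unit_gsrc -> /UG/unit_gsrc ->. Qed.

Lemma compact_bisection_src B :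
  compact_bisection B -> compact_bisection (@gsrc G @` B).
Proof.
have sU : @gsrc G @` B `<=` units G by move=> _ [b _ <-]; exact: units_gsrc.
move=> [oB cB rB sB]; split; [exact: open_src_image| |exact: unit_rng_inj|].
  apply: continuous_compact => //; apply: continuous_subspaceT.
  exact: gsrc_continuous.
exact: unit_src_inj.
Qed.

(** The inverse [h] of the range map on [B] is what makes factorisations through [B] depend
    continuously on the arrow. *)
Lemma rng_section B : compact_bisection B ->
  exists2 h : G -> G, (forall b, B b -> h (grng b) = b) &
    forall b, B b -> h @ grng b --> b.
Proof.
move=> [oB _ rB _].
have [h [_ hK _ hc]] := inj_open_homeo oB rB grng_continuous open_rng_image.
exists h => [b Bb|b Bb]; first by rewrite hK ?inE.
have : {in @grng G @` B, continuous h}.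
  by rewrite -continuous_open_subspace//; exact: open_rng_image.
move=> /(_ (grng b)); rewrite /continuous_at hK ?inE//; apply.
by exists b.
Qed.

(** Let [h] invert the range map on a bisection around [b] inside [U]. An arrow [x] near [gmul b c]
    factors as [d = h (grng x)] times [gmul (ginv d) x]; the second factor tends to [c], so it ends
    up in [V]. *)
Lemma open_setgmul U V : open U -> open V -> open (setgmul U V).
Proof.
move=> oU oV; rewrite openE => _ [b [c [Ub Vc bc ->]]].
have [B [cB Bb BU]] := compact_bisection_nbhs oU Ub.
have [h hK hc] := rng_section cB.
have rbc : grng (gmul b c) = grng b by rewrite grng_gmul.
have rc : @grng G @ gmul b c --> grng b.
  by rewrite -rbc; exact: grng_continuous.
have nB : nbhs (gmul b c) (@grng G @^-1` (@grng G @` B)).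
  apply: rc; apply: open_nbhs_nbhs; split; last by exists b.
  by apply: open_rng_image; case: cB.
have cv : gmul (ginv (h (grng x))) x @[x --> gmul b c] --> c.
  rewrite -[X in _ --> X](gmulKg bc); apply: cvg_ginv_gmul => //.
  - by apply: cvg_comp rc _; exact: hc.
  - by apply: filterS nB => x [d Bd dx]; rewrite -dx hK.
have nV : nbhs (gmul b c) [set x | V (gmul (ginv (h (grng x))) x)].
  by apply: cv; exact: open_nbhs_nbhs.
rewrite /interior; apply: filterS2 nB nV => x [d Bd dx] /=.
rewrite -dx hK// => Vdx; exists d, (gmul (ginv d) x); split=> //.
- exact: BU.
- by rewrite grng_gmul ?grng_ginv// gsrc_ginv.
- by rewrite gmulVKg.
Qed.

Hypothesis hT2 : hausdorff_space (units G).

(** A compact subset of [G] need not be closed, but its range is a compact subset of the Hausdorff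
    unit space, hence closed there; the set in question is a continuous preimage of it. *)
Lemma closed_src_preimage A : compact A ->
  closed (@gsrc G @^-1` (@grng G @` A)).
Proof.
move=> cA; have uA : closed (unit_rng @` A).
  apply: compact_closed => //; apply: continuous_compact => //.
  by apply: continuous_subspaceT; exact: unit_rng_continuous.
rewrite (_ : _ @^-1` _ = (unit_rng \o @ginv G) @^-1` (unit_rng @` A)).
  apply: closed_comp => // x _; apply: continuous_comp.
    exact: ginv_continuous.
  exact: unit_rng_continuous.
apply/seteqP; split=> x [a Aa] /= ax; exists a => //.
  by apply: val_inj; rewrite /= ax grng_ginv.
by move: ax => /(congr1 set_val); rewrite /= !val_unit_rng grng_ginv.
Qed.

Lemma compact_bisectionM B C : compact_bisection B -> compact_bisection C ->
  compact_bisection (setgmul B C).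
Proof.
move=> cB cC; have [oB kB rB sB] := cB; have [oC kC rC sC] := cC.
split; [exact: open_setgmul| |exact: setgmul_rng_inj|exact: setgmul_src_inj].
have [h hK hc] := rng_section cC.
(* [D] collects the arrows of [B] that are composable with one of [C]. It is compact, being a
   relatively closed part of [B], and the product set is its image under the continuous map sending
   [b] to [b] times the arrow of [C] with range [gsrc b]. *)
pose D := B `&` @gsrc G @^-1` (@grng G @` C).
have -> : setgmul B C = (fun x => gmul x (h (gsrc x))) @` D.
  apply/seteqP; split=> [_ [b [c [Bb Cc bc ->]]]|_ [b [Bb [c Cc cb]] <-]].
    by exists b; [split=> //; exists c|rewrite bc hK].
  by exists b, c; split=> //; rewrite -cb hK.
apply: continuous_compact; last first.
  by apply: compact_closedI => //; exact: closed_src_preimage.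
apply/subspace_continuousP => b [Bb [c Cc cb]].
have sb : @gsrc G @ within D (nbhs b) --> grng c.
  by rewrite cb; apply: cvg_within_filter; exact: gsrc_continuous.
apply: gmul_cvg => //.
- by rewrite -cb hK.
- exact: cvg_within.
- by rewrite -cb hK//; apply: cvg_comp sb _; exact: hc.
- rewrite near_withinE; apply: nearW => x [_ [d Cd dx]].
  by rewrite -dx hK.
Qed.

End GroupoidTopology.

(** * Convolution and the Steinberg algebra *)

Lemma pred_eqfun T U (P : (T -> U) -> Prop) f g : f =1 g -> P f -> P g.
Proof. by move=> /funext ->. Qed.

(** A sum with infinite support has the default value 0, hence the finiteness hypotheses. All three
    sums are cut down to the union [S] of the two supports. *)
Lemma fsum_lin (R : idomainType) (T : choiceType) (P : set T) (c : R)
    (f g : T -> R) :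
    finite_set (P `&` [set x | f x != 0]) ->
    finite_set (P `&` [set x | g x != 0]) ->
  \sum_(x \in P) (c * f x + g x) =
  c * (\sum_(x \in P) f x) + \sum_(x \in P) g x.
Proof.
move=> ff fg; pose S := P `&` [set x | f x != 0] `|` P `&` [set x | g x != 0].
have S0 x : (P `\` S) x -> f x = 0 /\ g x = 0.
  by move=> [Px Sx]; split; apply: contra_notP Sx => /eqP ?; [left|right].
have fS : finite_set S by rewrite finite_setU.
have SP : S `<=` P by move=> x [[]|[]].
have widen (h : T -> R) : (forall x, (P `\` S) x -> h x = 0) ->
  \sum_(x \in P) h x = \sum_(x \in S) h x.
  by move=> h0; apply/esym; apply: (fsbig_widen S P h SP).
rewrite !widen; first by rewrite fsbig_split// mulr_fsumr.
all: by move=> x /S0[f0 g0]; rewrite ?f0 ?g0 ?mulr0 ?addr0.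
Qed.

Section Convolution.
Variables (K : fieldType) (G : topGroupoidType).
Implicit Types (f g : G -> K) (A B : set G) (c : K).

(** Ensures that the sum defining [conv f g] has finite support, whatever [g] is. *)
Definition rfinite f :=
  forall u, finite_set ([set y | grng y = u] `&` [set y | f y != 0]).

Lemma rfinite_indic B : rng_inj B -> rfinite \1_B.
Proof.
move=> rB u; case: (pselect (exists2 b, B b & grng b = u)) => [[b Bb bu]|nB].
  apply: (sub_finite_set _ (finite_set1 b)) => y [/= yu]; rewrite indicE.
  case: (boolP (y \in B)) => [/set_mem By _|]; last by rewrite eqxx.
  by apply: rB; rewrite ?yu.
apply: (sub_finite_set _ (finite_set0 G)) => y [/= yu]; rewrite indicE.
case: (boolP (y \in B)) => [/set_mem By _|]; last by rewrite eqxx.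
by apply: nB; exists y.
Qed.

Lemma rfinite_lin c f g : rfinite f -> rfinite g ->
  rfinite (fun x => c * f x + g x).
Proof.
move=> ff fg u.
have fU : finite_set (([set y | grng y = u] `&` [set y | f y != 0]) `|`
                      ([set y | grng y = u] `&` [set y | g y != 0])).
  by rewrite finite_setU.
apply: (sub_finite_set _ fU) => y [/= yu].
have [f0|f0] := eqVneq (f y) 0; last by left.
by rewrite f0 mulr0 add0r; right.
Qed.

Lemma conv_linl c f1 f2 g : rfinite f1 -> rfinite f2 ->
  conv (fun x => c * f1 x + f2 x) g = fun x => c * conv f1 g x + conv f2 g x.
Proof.
move=> ff1 ff2; apply/funext => x; rewrite /conv -fsum_lin.
- by apply: eq_fsbigr => y _; rewrite mulrDl mulrA.
- apply: (sub_finite_set _ (ff1 (grng x))) => y [yx /= fy].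
  by split=> //=; apply: contra_neq fy => ->; rewrite mul0r.
- apply: (sub_finite_set _ (ff2 (grng x))) => y [yx /= fy].
  by split=> //=; apply: contra_neq fy => ->; rewrite mul0r.
Qed.

Lemma conv_linr c f g1 g2 : rfinite f ->
  conv f (fun x => c * g1 x + g2 x) = fun x => c * conv f g1 x + conv f g2 x.
Proof.
move=> ff; apply/funext => x; rewrite /conv -fsum_lin.
- by apply: eq_fsbigr => y _; rewrite mulrDr mulrCA.
- apply: (sub_finite_set _ (ff (grng x))) => y [yx /= fy].
  by split=> //=; apply: contra_neq fy => ->; rewrite mul0r.
- apply: (sub_finite_set _ (ff (grng x))) => y [yx /= fy].
  by split=> //=; apply: contra_neq fy => ->; rewrite mul0r.
Qed.

Lemma conv0l f : conv (fun=> 0) f = fun=> 0.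
Proof. by apply/funext => x; rewrite /conv fsbig1// => y _; rewrite mul0r. Qed.

Lemma conv0r f : conv f (fun=> 0) = fun=> 0.
Proof. by apply/funext => x; rewrite /conv fsbig1// => y _; rewrite mulr0. Qed.

Lemma indic_in A x : A x -> \1_A x = 1 :> K.
Proof. by move=> Ax; rewrite indicE mem_set. Qed.

Lemma indic_out A x : ~ A x -> \1_A x = 0 :> K.
Proof. by move=> Ax; rewrite indicE memNset. Qed.

Lemma conv_single f g x y : grng y = grng x ->
    (forall z, grng z = grng x -> z <> y -> f z * g (gmul (ginv z) x) = 0) ->
  conv f g x = f y * g (gmul (ginv y) x).
Proof.
move=> yx y0; rewrite /conv -(fsbig_widen [set y])/= ?fsbig_set1//.
  by move=> _ ->.
by move=> z [/= zx /(y0 _ zx)].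
Qed.

Lemma conv_indicl_in B f b x : rng_inj B -> B b -> grng b = grng x ->
  conv \1_B f x = f (gmul (ginv b) x).
Proof.
move=> rB Bb bx; rewrite (@conv_single _ _ _ b)// ?indic_in ?mul1r//.
move=> z zx zb; rewrite indic_out ?mul0r// => Bz.
by apply: zb; apply: rB; rewrite ?zx.
Qed.

Lemma conv_indicl_out B f x : ~ (@grng G @` B) (grng x) -> conv \1_B f x = 0.
Proof.
move=> nB; rewrite /conv fsbig1// => z zx; rewrite indic_out ?mul0r// => Bz.
by apply: nB; exists z.
Qed.

(** A term [z] survives only if [gmul (ginv z) x] lies in [B]. That arrow has the source of [b], so
    it equals [b], which forces [z = gmul x (ginv b)]. *)
Lemma conv_indicr_in B f b x : src_inj B -> B b -> gsrc b = gsrc x ->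
  conv f \1_B x = f (gmul x (ginv b)).
Proof.
move=> sB Bb bx; have xb : gsrc x = grng (ginv b) by rewrite grng_ginv.
pose y := gmul x (ginv b); have xE : x = gmul y b by rewrite gmulgKV.
have yb : gsrc y = grng b by rewrite gsrc_gmul// gsrc_ginv.
have yxb : gmul (ginv y) x = b by rewrite xE gmulKg.
rewrite (@conv_single _ _ _ y); first by rewrite yxb indic_in// mulr1.
  by rewrite grng_gmul.
move=> z zx zy; rewrite indic_out ?mulr0// => Bz; apply: zy.
rewrite /y -(sB _ _ Bz Bb) ?gsrc_gmul ?gsrc_ginv ?bx//.
rewrite -{1}(gmulVKg zx) gmulgK//.
by rewrite grng_gmul ?grng_ginv ?gsrc_ginv.
Qed.

Lemma conv_indicr_out B f x : ~ (@gsrc G @` B) (gsrc x) -> conv f \1_B x = 0.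
Proof.
move=> nB; rewrite /conv fsbig1// => z zx; rewrite indic_out ?mulr0// => Bz.
by apply: nB; exists (gmul (ginv z) x); rewrite // gsrc_gmul// gsrc_ginv.
Qed.

Lemma conv_indic A B : rng_inj A ->
  conv \1_A \1_B = \1_(setgmul A B) :> (G -> K).
Proof.
move=> rA; apply/funext => x.
case: (pselect ((@grng G @` A) (grng x))) => [[a Aa ax]|nA].
  rewrite (conv_indicl_in _ rA Aa ax).
  case: (pselect (B (gmul (ginv a) x))) => [Bx|nB].
    rewrite !indic_in//; exists a, (gmul (ginv a) x); split=> //.
      by rewrite grng_gmul ?grng_ginv ?gsrc_ginv.
    by rewrite gmulVKg.
  rewrite !indic_out// => -[a' [b [Aa' Bb ab xE]]]; apply: nB.
  by rewrite xE (rA a a')// ?ax ?xE ?grng_gmul// gmulKg.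
rewrite conv_indicl_out// indic_out// => -[a [b [Aa Bb ab xE]]].
by apply: nA; exists a; rewrite // xE grng_gmul.
Qed.

End Convolution.

(** * Closure properties of the Steinberg algebra and a criterion for ideals *)

Section Steinberg.
Variables (K : fieldType) (G : topGroupoidType).
Hypothesis hample : ample G.
Implicit Types (f g : G -> K) (A B : set G) (c : K).

Lemma steinberg0 : @steinberg K G (fun=> 0).
Proof.
exists 0, (fun=> 0), (fun=> set0); split; first by case.
by apply/funext => x; rewrite big_ord0.
Qed.

Lemma steinberg_cons c B f : compact_bisection B -> steinberg f ->
  steinberg (fun x => c * \1_B x + f x).
Proof.
move=> cB [n [d [D [hD ->]]]].
exists n.+1, (fun i => if unlift ord0 i is Some j then d j else c),
  (fun i => if unlift ord0 i is Some j then D j else B); split=> [i|].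
  by case: unliftP => [j _|_]; [exact: hD|exact/compact_open_bisectionP].
apply/funext => x; rewrite big_ord_recl unlift_none; congr +%R.
by apply: eq_bigr => i _; rewrite liftK.
Qed.

Lemma steinberg_ind (P : (G -> K) -> Prop) :
    P (fun=> 0) ->
    (forall c B f, compact_bisection B -> steinberg f -> P f ->
      P (fun x => c * \1_B x + f x)) ->
  forall f, steinberg f -> P f.
Proof.
move=> P0 PS f [n [c [B [hB ->]]]].
elim: n c B hB => [|n IHn] c B hB.
  by apply: pred_eqfun P0 => x; rewrite big_ord0.
pose c' i := c (lift ord0 i); pose B' i := B (lift ord0 i).
have hB' i : compact_open_bisection (B' i) by exact: hB.
have sB' : steinberg (fun x => \sum_(i < n) c' i * \1_(B' i) x).
  by exists n, c', B'.
have cB0 : compact_bisection (B ord0) by exact/compact_open_bisectionP.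
apply: (pred_eqfun _ (PS (c ord0) _ _ cB0 sB' (IHn c' B' hB'))) => x.
by rewrite big_ord_recl.
Qed.

Lemma steinberg_indic B : compact_bisection B -> steinberg (\1_B : G -> K).
Proof.
move=> cB; apply: (pred_eqfun _ (steinberg_cons 1 cB steinberg0)).
by move=> x; rewrite mul1r addr0.
Qed.

Lemma steinberg_lin c f g : steinberg f -> steinberg g ->
  steinberg (fun x => c * f x + g x).
Proof.
move=> + sg; move: f; apply: steinberg_ind => [|d B f cB sf IH].
  by apply: (pred_eqfun _ sg) => x; rewrite mulr0 add0r.
apply: (pred_eqfun _ (steinberg_cons (c * d) cB IH)).
by move=> x; rewrite mulrDr mulrA addrA.
Qed.

Lemma steinberg_rfinite f : steinberg f -> rfinite f.
Proof.
move: f; apply: steinberg_ind => [u|c B f [_ _ rB _] _ ff].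
  by apply: (sub_finite_set _ (finite_set0 G)) => y [_ /=]; rewrite eqxx.
by apply: rfinite_lin => //; exact: rfinite_indic.
Qed.

Hypothesis hT2 : hausdorff_space (units G).

Lemma steinberg_conv_indicl B f : compact_bisection B -> steinberg f ->
  steinberg (conv \1_B f).
Proof.
move=> cB; have rB : rng_inj B by case: cB.
move: f; apply: steinberg_ind => [|c C f cC sf IH].
  by rewrite conv0r; exact: steinberg0.
rewrite conv_linr; last exact: rfinite_indic.
rewrite conv_indic//; apply: steinberg_cons => //.
exact: compact_bisectionM.
Qed.

Lemma steinberg_conv_indicr B f : compact_bisection B -> steinberg f ->
  steinberg (conv f \1_B).
Proof.
move=> cB; move: f; apply: steinberg_ind => [|c C f cC sf IH].
  by rewrite conv0l; exact: steinberg0.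
have rC : rng_inj C by case: cC.
rewrite conv_linl; [|exact: rfinite_indic|exact: steinberg_rfinite].
rewrite conv_indic//; apply: steinberg_cons => //.
exact: compact_bisectionM.
Qed.

(** Indicators of compact open bisections span the algebra and convolution is linear in each
    argument, so absorption need only be tested on these indicators. *)
Lemma two_sided_idealI (I : set (G -> K)) :
    I `<=` @steinberg K G -> I (fun=> 0) ->
    (forall c f g, I f -> I g -> I (fun x => c * f x + g x)) ->
    (forall B f, compact_bisection B -> I f ->
       I (conv \1_B f) /\ I (conv f \1_B)) ->
  two_sided_ideal I.
Proof.
move=> IS I0 IL IB; split=> //.
- move=> f g If Ig; apply: (pred_eqfun _ (IL 1 _ _ If Ig)).
  by move=> x; rewrite mul1r.
- move=> c f If; apply: (pred_eqfun _ (IL c _ _ If I0)).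
  by move=> x; rewrite addr0.
move=> f g + Ig; move: f; apply: steinberg_ind.
  by rewrite conv0l conv0r.
move=> c B f cB sf [IHl IHr]; have [Il Ir] := IB _ _ cB Ig.
have rB : rng_inj B by case: cB.
rewrite conv_linl; [|exact: rfinite_indic|exact: steinberg_rfinite].
rewrite conv_linr; last by apply: steinberg_rfinite; exact: IS.
by split; exact: IL.
Qed.

End Steinberg.

(** * Three ideals *)

Section Ideals.
Variables (K : fieldType) (G : topGroupoidType).
Implicit Types (f : G -> K) (A B U V W : set G) (c : K).

Lemma conv_unitl W f : W `<=` units G ->
  conv \1_W f = fun x => \1_W (grng x) * f x.
Proof.
move=> WG; apply/funext => x; have rW := unit_rng_inj WG.
case: (pselect (W (grng x))) => [Wx|nW].
  rewrite (conv_indicl_in _ rW Wx) ?grng_grng// indic_in// mul1r.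
  by rewrite (ginv_unit (WG _ Wx)) gmul_grng.
rewrite conv_indicl_out ?indic_out ?mul0r// => -[w Ww wx]; apply: nW.
by rewrite -wx (WG _ Ww).
Qed.

Lemma conv_unitr W f : W `<=` units G ->
  conv f \1_W = fun x => f x * \1_W (gsrc x).
Proof.
move=> WG; apply/funext => x; have sW := unit_src_inj WG.
case: (pselect (W (gsrc x))) => [Wx|nW].
  rewrite (conv_indicr_in _ sW Wx) ?gsrc_gsrc// indic_in// mulr1.
  by rewrite (ginv_unit (WG _ Wx)) gmul_gsrc.
rewrite conv_indicr_out ?indic_out ?mulr0// => -[w Ww wx]; apply: nW.
by rewrite -wx (unit_gsrc (WG _ Ww)).
Qed.

Lemma conv_indicl_cases B f x : rng_inj B ->
  (exists b, [/\ B b, grng b = grng x &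
     conv \1_B f x = f (gmul (ginv b) x)]) \/ conv \1_B f x = 0.
Proof.
move=> rB; case: (pselect ((@grng G @` B) (grng x))) => [[b Bb bx]|nB].
  by left; exists b; split=> //; exact: conv_indicl_in.
by right; exact: conv_indicl_out.
Qed.

Lemma conv_indicr_cases B f x : src_inj B ->
  (exists b, [/\ B b, gsrc b = gsrc x &
     conv f \1_B x = f (gmul x (ginv b))]) \/ conv f \1_B x = 0.
Proof.
move=> sB; case: (pselect ((@gsrc G @` B) (gsrc x))) => [[b Bb bx]|nB].
  by left; exists b; split=> //; exact: conv_indicr_in.
by right; exact: conv_indicr_out.
Qed.

(** Vanishing on a dense open set. For an arbitrary function this is stronger than a support with
    empty interior, and unlike the latter it passes directly to linear combinations. *)
Definition singular f := forall U, open U -> U !=set0 ->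
  exists V, [/\ open V, V !=set0, V `<=` U & forall x, V x -> f x = 0].

Lemma singular_lin c f g : singular f -> singular g ->
  singular (fun x => c * f x + g x).
Proof.
move=> nf ng U oU U0; have [V [oV V0 VU fV]] := nf U oU U0.
have [W [oW W0 WV gW]] := ng V oV V0.
exists W; split=> // [x /WV/VU//|x Wx].
by rewrite fV ?gW ?mulr0 ?addr0//; exact: WV.
Qed.

(** The sum is the coefficient of [v] in the image of the basis vector [u] under the action of [f]
    on the free module on the units. *)
Definition fibre_sums0 f := forall v u,
  \sum_(x \in [set x | grng x = v /\ gsrc x = u]) f x = 0.

Lemma fibre_sums0_lin c f g : rfinite f -> rfinite g ->
  fibre_sums0 f -> fibre_sums0 g -> fibre_sums0 (fun x => c * f x + g x).
Proof.
move=> ff fg f0 g0 v u; rewrite fsum_lin ?f0 ?g0 ?mulr0 ?addr0//.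
  by apply: (sub_finite_set _ (ff v)) => x [[]].
by apply: (sub_finite_set _ (fg v)) => x [[]].
Qed.

(** If [b] is the arrow of [B] with range [v], left translation by [ginv b] is a bijection from the
    arrows [u] to [v] onto the arrows [u] to [gsrc b]. If there is no such arrow, every term is
    zero. *)
Lemma fibre_sums0_convl B f : rng_inj B -> fibre_sums0 f ->
  fibre_sums0 (conv \1_B f).
Proof.
move=> rB f0 v u.
case: (pselect ((@grng G @` B) v)) => [[b Bb bv]|nB]; last first.
  by apply: fsbig1 => x [xv _]; rewrite conv_indicl_out// xv.
rewrite -[RHS](f0 (gsrc b) u).
rewrite [RHS](@reindex_fsbig _ _ _ _ _ (gmul (ginv b))
  [set x | grng x = v /\ gsrc x = u]).
  apply: eq_fsbigr => x /set_mem[xv xu].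
  by rewrite (conv_indicl_in _ rB Bb)// bv.
split=> [x [xv xu]|x y /set_mem[xv xu] /set_mem[yv yu] e|x [xb xu]] /=.
- by rewrite grng_gmul ?gsrc_gmul ?gsrc_ginv ?grng_ginv// bv xv.
- by rewrite -(@gmulVKg _ b x) ?e ?gmulVKg// bv.
- exists (gmul b x); last by rewrite gmulKg.
  by rewrite /= grng_gmul// gsrc_gmul.
Qed.

Lemma fibre_sums0_convr B f : src_inj B -> fibre_sums0 f ->
  fibre_sums0 (conv f \1_B).
Proof.
move=> sB f0 v u.
case: (pselect ((@gsrc G @` B) u)) => [[b Bb bu]|nB]; last first.
  by apply: fsbig1 => x [_ xu]; rewrite conv_indicr_out// xu.
rewrite -[RHS](f0 v (grng b)).
rewrite [RHS](@reindex_fsbig _ _ _ _ _ (fun x => gmul x (ginv b))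
  [set x | grng x = v /\ gsrc x = u]).
  apply: eq_fsbigr => x /set_mem[xv xu].
  by rewrite (conv_indicr_in _ sB Bb)// bu.
split=> [x [xv xu]|x y /set_mem[xv xu] /set_mem[yv yu] e|x [xv xb]] /=.
- by rewrite grng_gmul ?gsrc_gmul ?gsrc_ginv ?grng_ginv// bu xu.
- by rewrite -(@gmulgKV _ x b) ?e ?gmulgKV// bu.
- exists (gmul x b); last by rewrite gmulgK.
  by rewrite /= grng_gmul// gsrc_gmul.
Qed.

Lemma sum_indic1 B P b : B b -> P b ->
  (forall x, P x -> B x -> x = b) -> \sum_(x \in P) (\1_B x : K) = 1.
Proof.
move=> Bb Pb Pu; transitivity (\sum_(x \in [set b]) (\1_B x : K)).
  apply/esym; apply: fsbig_widen => [_ ->//|x [Px xb]] /=.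
  by rewrite indic_out// => Bx; apply: xb; exact: Pu.
by rewrite fsbig_set1 indic_in.
Qed.

Hypothesis hample : ample G.

(** A bisection need not be closed, so its indicator may fail to be locally constant. Still, a
    nonempty open [V] either meets [B] in a nonempty open set or misses it, and the indicator is
    constant in both cases. *)
Lemma steinberg_loc_const f : steinberg f -> forall U, open U -> U !=set0 ->
  exists V k, [/\ open V, V !=set0, V `<=` U & forall x, V x -> f x = k].
Proof.
move: f; apply: (steinberg_ind hample).
  by move=> U oU U0; exists U, 0; split.
move=> c B f [oB _ _ _] _ IH U oU U0.
have [V [k [oV V0 VU Vk]]] := IH U oU U0.
case: (pselect (V `&` B !=set0)) => [VB|nVB].
  exists (V `&` B), (c + k); split=> //; [exact: openI|by move=> x [/VU]|].
  by move=> x [Vx Bx]; rewrite indic_in// mulr1 Vk.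
exists V, k; split=> // x Vx; rewrite indic_out ?mulr0 ?add0r ?Vk// => Bx.
by apply: nVB; exists x.
Qed.

Lemma nonsingular_supp f : steinberg f -> ~ singular f -> (supp f)° !=set0.
Proof.
move=> sf nf; apply: contrapT => supp0; apply: nf => U oU U0.
have [V [k [oV [v Vv] VU fV]]] := steinberg_loc_const sf oU U0.
exists V; split=> //; first by exists v.
move=> x Vx; rewrite fV//; apply: contrapT => /eqP k0; apply: supp0; exists v.
have : nbhs v V by exact: open_nbhs_nbhs.
by apply: filterS => y Vy; rewrite /supp /= fV.
Qed.

(** The part [W] of [U] with range in that of [B] is moved by the inverse of [B], an open [V] on
    which [f] vanishes is found there, and [V] is moved back by [B]. Injectivity of the source on
    [B] keeps the result inside [U]. *)
Lemma singular_convl B f : compact_bisection B -> singular f ->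
  singular (conv \1_B f).
Proof.
move=> [oB _ rB sB] nf U oU U0.
pose W := U `&` @grng G @^-1` (@grng G @` B).
have oW : open W.
  by apply: openI => //; apply: open_rng_preimage; exact: open_rng_image.
case: (pselect (W !=set0)) => [[x [Ux [b Bb bx]]]|nW]; last first.
  exists U; split=> // x Ux; rewrite conv_indicl_out// => Bx.
  by apply: nW; exists x.
have oB' : open (@ginv G @^-1` B).
  by exact: open_ginv_preimage.
have [||V [oV [v Vv] VW fV]] := nf (setgmul (@ginv G @^-1` B) W).
- exact: open_setgmul.
- exists (gmul (ginv b) x), (ginv b), x; split=> //=; rewrite ?ginvK//.
    by split=> //; exists b.
  by rewrite gsrc_ginv.
have VWP y : V y -> forall d, B d -> gsrc d = grng y -> W (gmul d y).
  move=> /VW[a [w [Ba Ww aw ->]]] d Bd; rewrite grng_gmul// -gsrc_ginv.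
  by move=> /(sB _ _ Bd Ba) ->; rewrite gmulKg.
exists (setgmul B V); split.
- exact: open_setgmul.
- have [a [w [Ba Ww aw vE]]] := VW _ Vv.
  exists (gmul (ginv a) v), (ginv a), v; split=> //.
  by rewrite gsrc_ginv vE grng_gmul.
- by move=> _ [c [y [Bc Vy cy ->]]]; have [] := VWP _ Vy _ Bc cy.
- move=> _ [c [y [Bc Vy cy ->]]].
  by rewrite (conv_indicl_in _ rB Bc) ?grng_gmul// gmulKg// fV.
Qed.

Lemma singular_convr B f : compact_bisection B -> singular f ->
  singular (conv f \1_B).
Proof.
move=> [oB _ rB sB] nf U oU U0.
pose W := U `&` @gsrc G @^-1` (@gsrc G @` B).
have oW : open W.
  by apply: openI => //; apply: open_src_preimage; exact: open_src_image.
case: (pselect (W !=set0)) => [[x [Ux [b Bb bx]]]|nW]; last first.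
  exists U; split=> // x Ux; rewrite conv_indicr_out// => Bx.
  by apply: nW; exists x.
have oB' : open (@ginv G @^-1` B).
  by exact: open_ginv_preimage.
have [||V [oV [v Vv] VW fV]] := nf (setgmul W (@ginv G @^-1` B)).
- exact: open_setgmul.
- exists (gmul x (ginv b)), x, (ginv b); split=> //=; rewrite ?ginvK//.
    by split=> //; exists b.
  by rewrite grng_ginv.
have VWP y : V y -> forall d, B d -> gsrc y = grng d -> W (gmul y d).
  move=> /VW[w [a [Ww Ba wa ->]]] d Bd; rewrite gsrc_gmul// -grng_ginv.
  by move=> /(rB _ _ Ba Bd) <-; rewrite gmulgK.
exists (setgmul V B); split.
- exact: open_setgmul.
- have [w [a [Ww Ba wa vE]]] := VW _ Vv.
  exists (gmul v (ginv a)), v, (ginv a); split=> //.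
  by rewrite grng_ginv vE gsrc_gmul.
- by move=> _ [y [c [Vy Bc cy ->]]]; have [] := VWP _ Vy _ Bc cy.
- move=> _ [y [c [Vy Bc cy ->]]].
  by rewrite (conv_indicr_in _ sB Bc) ?gsrc_gmul// gmulgK// fV.
Qed.

Hypothesis hT2 : hausdorff_space (units G).

(** Left translation preserves the source, and right translation by an arrow moves the source within
    its orbit. *)
Lemma vanishing_ideal (u : G) :
  two_sided_ideal [set f : G -> K |
    steinberg f /\ forall x, orbit u (gsrc x) -> f x = 0].
Proof.
apply: two_sided_idealI => //.
- by move=> f [].
- by split=> //; exact: steinberg0.
- move=> c f g [sf f0] [sg g0]; split; first exact: steinberg_lin.
  by move=> x xu; rewrite f0// g0// mulr0 addr0.
move=> B f cB [sf f0]; have [_ _ rB sB] := cB; split; split.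
- exact: steinberg_conv_indicl.
- move=> x ux; have [[b [Bb bx ->]]|//] := conv_indicl_cases f x rB.
  by apply: f0; rewrite gsrc_gmul// gsrc_ginv.
- exact: steinberg_conv_indicr.
move=> x [y yu yx]; have [[b [Bb bx ->]]|//] := conv_indicr_cases f x sB.
apply: f0; rewrite gsrc_gmul ?grng_ginv// gsrc_ginv.
have yb : gsrc y = grng (ginv b) by rewrite grng_ginv yx.
by exists (gmul y (ginv b)); rewrite /= ?grng_gmul// gsrc_gmul// gsrc_ginv.
Qed.

Lemma singular_ideal :
  two_sided_ideal [set f : G -> K | steinberg f /\ singular f].
Proof.
apply: two_sided_idealI => //.
- by move=> f [].
- by split; [exact: steinberg0|move=> U oU U0; exists U; split].
- move=> c f g [sf f0] [sg g0]; split; first exact: steinberg_lin.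
  exact: singular_lin.
- move=> B f cB [sf f0]; split; split.
  + exact: steinberg_conv_indicl.
  + exact: singular_convl.
  + exact: steinberg_conv_indicr.
  + exact: singular_convr.
Qed.

Lemma fibre_sums0_ideal :
  two_sided_ideal [set f : G -> K | steinberg f /\ fibre_sums0 f].
Proof.
apply: two_sided_idealI => //.
- by move=> f [].
- by split; [exact: steinberg0|move=> v u; exact: fsbig1].
- move=> c f g [sf f0] [sg g0]; split; first exact: steinberg_lin.
  by apply: fibre_sums0_lin => //; exact: steinberg_rfinite.
- move=> B f cB [sf f0]; have [_ _ rB sB] := cB; split; split.
  + exact: steinberg_conv_indicl.
  + exact: fibre_sums0_convl.
  + exact: steinberg_conv_indicr.
  + exact: fibre_sums0_convr.
Qed.

End Ideals.

(** * Simplicity *)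

Lemma compact_finite_subset_cover (T : topologicalType) (I : choiceType)
    (A : set T) (D : set I) (f : I -> set T) :
    compact A -> (forall i, D i -> open (f i)) -> A `<=` cover D f ->
  finite_subset_cover D f A.
Proof.
have [->|/set0P[a _] cA] := eqVneq A set0; first by exists fset0.
(* [compact_cover] is only stated for pointed spaces. *)
pose pT : ptopologicalType :=
  HB.pack (Topological.sort T) (isPointed.Build T a).
have : @cover_compact pT A by rewrite -compact_cover; exact: cA.
by apply.
Qed.

Section Simplicity.
Variables (K : fieldType) (G : topGroupoidType).
Hypothesis hample : ample G.
Hypothesis hT2 : hausdorff_space (units G).
Implicit Types (f : G -> K) (A B C U V W : set G) (c : K).

(** * Simplicity implies the three conditions *)

Lemma simple_proper_ideal (I : set (G -> K)) : steinberg_simple K G ->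
  two_sided_ideal I -> forall f, steinberg f -> ~ I f -> I = [set (fun=> 0)].
Proof. by move=> S /S[//|->]. Qed.

Lemma indic_neq0 A x : A x -> \1_A <> (fun=> 0) :> (G -> K).
Proof. by move=> Ax /(congr1 (@^~ x))/eqP; rewrite indic_in// oner_eq0. Qed.

(** If [W] misses the orbit of [u], the vanishing ideal contains the indicator of a bisection [B] of
    units inside [W], but not that of a bisection [C] containing [u]. *)
Lemma simple_minimal : steinberg_simple K G -> minimal G.
Proof.
move=> S u uu; split=> [_ [x _ <-]|W [w Ww] oW]; first exact: units_gsrc.
apply: contrapT => W0.
have uru x : unit_rng (set_val x : G) = x :> units G.
  by apply: val_inj; rewrite /= (set_mem (valP x)).
pose U := units G `&` @unit_rng G @^-1` W.
have oU : open U.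
  apply: openI; first exact: open_units.
  by exact: open_unit_rng_preimage.
have Uw : U (set_val w) by split; [exact: (set_mem (valP w))|rewrite /= uru].
have [B [cB Bw BU]] := compact_bisection_nbhs hample oU Uw.
have [C [cC Cu _]] := compact_bisection_nbhs hample (open_units hample) uu.
have nC : ~ (steinberg (\1_C : G -> K) /\
    forall x, orbit u (gsrc x) -> \1_C x = 0 :> K).
  move=> [_ C0]; have /eqP : \1_C u = 0 :> K.
    by apply: C0; exists u => //=; rewrite unit_gsrc.
  by rewrite indic_in// oner_eq0.
have /seteqP[/(_ \1_B) IB _] := simple_proper_ideal S
  (vanishing_ideal K hample hT2 u) (steinberg_indic K hample cC) nC.
apply: (indic_neq0 Bw); apply: IB.
split; first exact: steinberg_indic.
move=> x xu; rewrite indic_out// => /BU[xx Wx]; apply: W0.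
exists (unit_rng x); split=> //=.
by rewrite /preimage/= val_unit_rng xx -(unit_gsrc xx).
Qed.

Lemma simple_supp : steinberg_simple K G ->
  forall f, steinberg f -> f <> (fun=> 0) -> (supp f)° !=set0.
Proof.
move=> S f sf f0; apply: (nonsingular_supp hample) => // nf; apply: f0.
(* An arrow is required to produce a nonempty bisection [C], whose indicator lies outside the ideal;
   without arrows [f] is zero trivially. *)
case: (pselect (exists x : G, True)) => [[x _]|noG]; last first.
  by apply/funext => x; case: noG; exists x.
have [C [cC Cx _]] := compact_bisection_nbhs hample openT (I : setT x).
have nC : ~ (steinberg (\1_C : G -> K) /\ singular (\1_C : G -> K)).
  have [oC _ _ _] := cC.
  move=> [_ /(_ C oC)][|V [_ [v Vv] VC /(_ _ Vv)/eqP]]; first by exists x.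
  by rewrite indic_in ?oner_eq0//; exact: VC.
have /seteqP[/(_ f) If _] := simple_proper_ideal S
  (singular_ideal K hample hT2) (steinberg_indic K hample cC) nC.
by apply: If.
Qed.

Lemma simple_effective : steinberg_simple K G -> effective G.
Proof.
move=> S; apply/seteqP; split=> [x Ix|x xx]; last first.
  apply: (@filterS _ _ _ (units G)); last first.
    by apply: open_nbhs_nbhs; split=> //; exact: open_units.
  by move=> y yy; rewrite /Iso/= unit_gsrc.
apply: contrapT => nx.
have [B [cB Bx BI]] := compact_bisection_nbhs hample (open_interior (Iso G)) Ix.
have {}BI b : B b -> grng b = gsrc b by move=> /BI /interior_subset.
have [oB kB rB sB] := cB.
have cD := compact_bisection_src hample cB.
have [_ _ rD _] := cD.
have DG u : (@gsrc G @` B) u -> units G u by move=> [b _ <-]; exact: units_gsrc.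
(* As range and source agree on [B], both indicators have fibre sum 1 when [u = v] lies in the
   source of [B] and 0 otherwise. At the non-unit [x] the value of [f] is 1. *)
pose f : G -> K := fun x => -1 * \1_(@gsrc G @` B) x + \1_B x.
have sf : steinberg f.
  by apply: (steinberg_cons hample) => //; exact: steinberg_indic.
have f0 : fibre_sums0 f.
  move=> v u; rewrite fsum_lin.
  - case: (pselect ((@gsrc G @` B) u /\ u = v)) => [[[b Bb bu] <-]|nuv].
      have uu : units G u by rewrite -bu; exact: units_gsrc.
      rewrite (@sum_indic1 _ _ _ _ u); [|by exists b| |].
      + rewrite (@sum_indic1 _ _ _ _ b)// ?mulN1r ?addNr//.
          by rewrite /= BI.
        by move=> y [_ yu] By; apply: sB; rewrite ?yu.
      + by split; [|exact: unit_gsrc].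
      + by move=> y [yu _] /DG <-.
    rewrite !fsbig1 ?mulr0 ?addr0// => y [yv yu]; rewrite indic_out//.
      move=> By; apply: nuv; split; first by exists y.
      by rewrite -yu -yv BI.
    move=> By; have yy := DG _ By; apply: nuv.
    by rewrite -yu -yv (unit_gsrc yy) yy.
  - apply: (sub_finite_set _ (rfinite_indic K rD v)) => y [[]//].
  - apply: (sub_finite_set _ (rfinite_indic K rB v)) => y [[]//].
pose D := @gsrc G @` B.
have nD : ~ (steinberg (\1_D : G -> K) /\ fibre_sums0 (\1_D : G -> K)).
  move=> [_ /(_ (gsrc x) (gsrc x))]/eqP.
  rewrite (@sum_indic1 _ _ _ _ (gsrc x)) ?oner_eq0//.
  - by exists x.
  - by split; rewrite ?grng_gsrc ?gsrc_gsrc.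
  - by move=> y [yx _] /DG; rewrite /units/= yx.
have /seteqP[/(_ f) If _] := simple_proper_ideal S
  (fibre_sums0_ideal K hample hT2) (steinberg_indic K hample cD) nD.
have /(congr1 (@^~ x))/eqP : f = (fun=> 0) by apply: If.
rewrite /f (indic_in _ Bx) indic_out.
  by rewrite mulr0 add0r oner_eq0.
by move=> /DG.
Qed.

(** * The three conditions imply simplicity *)

Hypothesis heff : effective G.

(** If [V] meets [B], an arrow of [B] with range in the intersection is that unit itself, and
    [k = 1]. Otherwise [k = 0]: either no arrow of [B] has range in [V], or some [y] in [B] does and
    has distinct range and source, and separating these two units gives a [V'] that no arrow of [B]
    joins to itself. *)
Lemma indic_compress B V : open B -> rng_inj B -> open V -> V !=set0 ->
    V `<=` units G ->
  exists V' (k : K), [/\ open V', V' !=set0, V' `<=` V &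
    forall x, V' (grng x) -> V' (gsrc x) -> \1_B x = k * \1_(units G) x].
Proof.
move=> oB rB oV V0 VG.
case: (pselect (V `&` B !=set0)) => [VB|nVB].
  exists (V `&` B), 1; split=> //; first exact: openI.
  move=> x [Vx Bx] _; rewrite mul1r.
  case: (pselect (units G x)) => [xx|nx].
    by rewrite !indic_in// -xx.
  rewrite !indic_out// => Bx'; apply: nx.
  by rewrite (rB x (grng x)) ?grng_grng//; exact: units_grng.
pose B' := B `&` @grng G @^-1` V.
have oB' : open B' by apply: openI => //; exact: open_rng_preimage.
case: (pselect (B' !=set0)) => [[b B'b]|nB']; last first.
  exists V, 0; split=> // x Vx _; rewrite mul0r indic_out// => Bx.
  by apply: nB'; exists x.
(* If [B'] consisted of isotropy, effectiveness would make [b] a unit, and [b] would lie in both [V]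
   and [B]. *)
have [y B'y yy] : exists2 y, B' y & grng y <> gsrc y.
  apply: contrapT => nB'; apply: nVB; exists b.
  have bb : units G b.
    rewrite -heff; apply: (@filterS _ _ _ B').
      by move=> z B'z; apply: contrapT => zz; apply: nB'; exists z.
    exact: open_nbhs_nbhs.
  by case: B'b => Bb /=; rewrite bb.
have ry : unit_rng y != unit_rng (ginv y).
  by apply/eqP => /(congr1 set_val); rewrite /= !val_unit_rng grng_ginv.
have := hT2; rewrite open_hausdorff => /(_ _ _ ry)[[P Q]] /= [/set_mem Py].
move=> /set_mem Qy [oP oQ /eqP PQ].
have oP' : open (@unit_rng G @^-1` P).
  by exact: open_unit_rng_preimage.
have oQ' : open ((@unit_rng G \o @ginv G) @^-1` Q).
  apply: open_comp => // z _; apply: continuous_comp.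
    exact: ginv_continuous.
  exact: unit_rng_continuous.
pose W := B' `&` @unit_rng G @^-1` P `&` (@unit_rng G \o @ginv G) @^-1` Q.
have oW : open W by apply: openI => //; exact: openI.
exists (@grng G @` W), 0; split.
- exact: open_rng_image.
- by exists (grng y), y.
- by move=> _ [z [[[_ Vz] _] _] <-].
move=> x [z [[[Bz _] _] Qz] zx] [w [[_ Pw] _] wx].
rewrite mul0r indic_out// => Bx.
have zE : z = x by exact: rB.
suff : (P `&` Q) (unit_rng w) by rewrite PQ.
split=> //; rewrite /= zE /= in Qz.
suff -> : unit_rng w = unit_rng (ginv x) by [].
by apply: val_inj; rewrite /= wx grng_ginv.
Qed.

Lemma steinberg_compress f : steinberg f ->
  forall V, open V -> V !=set0 -> V `<=` units G ->
  exists V' k, [/\ open V', V' !=set0, V' `<=` V &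
    forall x, V' (grng x) -> V' (gsrc x) -> f x = k * \1_(units G) x].
Proof.
move: f; apply: (steinberg_ind hample).
  by move=> V oV V0 VG; exists V, 0; split=> // x; rewrite mul0r.
move=> c B f [oB _ rB _] _ IH V oV V0 VG.
have [W [k [oW W0 WV fW]]] := IH V oV V0 VG.
have [W' [l [oW' W'0 W'W BW]]] :=
  indic_compress oB rB oW W0 (subset_trans WV VG).
exists W', (c * l + k); split=> // [|x rx sx]; first exact: subset_trans WV.
by rewrite BW// fW ?mulrDl ?mulrA//; exact: W'W.
Qed.

Hypothesis hmin : minimal G.
Hypothesis hsupp :
  forall f, steinberg f -> f <> (fun=> 0) -> (supp f)° !=set0.

Variable I : set (G -> K).
Hypothesis hI : two_sided_ideal I.

Lemma ideal_convl B f : compact_bisection B -> I f -> I (conv \1_B f).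
Proof.
case: hI => _ _ _ _ IM cB If.
by have [] := IM _ _ (steinberg_indic K hample cB) If.
Qed.

Lemma ideal_convr B f : compact_bisection B -> I f -> I (conv f \1_B).
Proof.
case: hI => _ _ _ _ IM cB If.
by have [] := IM _ _ (steinberg_indic K hample cB) If.
Qed.

Lemma ideal_unit_indic f : I f -> f <> (fun=> 0) ->
  exists W, [/\ compact_bisection W, W !=set0, W `<=` units G & I \1_W].
Proof.
case: hI => IS _ _ IZ _ If f0.
have [b0 fb0] := hsupp (IS _ If) f0.
have [B [cB Bb0 BU]] :=
  compact_bisection_nbhs hample (open_interior (supp f)) fb0.
have cC := compact_bisectionV cB.
pose g := conv f \1_(@ginv G @^-1` B).
have Ig : I g by exact: ideal_convr.
have gB b : B b -> g (grng b) != 0.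
  have [_ _ rB sB] := cC => Bb.
  rewrite /g (@conv_indicr_in _ _ _ _ (ginv b))//=.
  - by rewrite ginvK gmul_grng; exact: (interior_subset (BU _ Bb)).
  - by rewrite ginvK.
  - by rewrite gsrc_ginv gsrc_grng.
have [oB _ _ _] := cB.
have [|_ [b _ <-]|V [k [oV [v Vv] VB gV]]] :=
  steinberg_compress (IS _ Ig) (open_rng_image hample oB).
- by exists (grng b0), b0.
- exact: units_grng.
have VG x : V x -> units G x by move=> /VB[b _ <-]; exact: units_grng.
have [W [cW Wv WV]] := compact_bisection_nbhs hample oV Vv.
have WG : W `<=` units G := subset_trans WV VG.
have k0 : k != 0.
  have [b Bb bv] := VB _ Vv; have := gB _ Bb; rewrite bv gV.
  - by apply: contra_neq => ->; rewrite mul0r.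
  - by rewrite (VG _ Vv).
  - by rewrite (unit_gsrc (VG _ Vv)).
(* Cutting by [W] on both sides keeps only arrows with range and source in [V], where [g] is [k]
   times the indicator of the units. *)
have kW : conv (conv \1_W g) \1_W = fun x => k * \1_W x.
  rewrite conv_unitr// conv_unitl//; apply/funext => x.
  case: (pselect (W x)) => [Wx|nWx].
    have [xr xs] := (WG _ Wx, unit_gsrc (WG _ Wx)).
    have rx : W (grng x) by rewrite xr.
    have sx : W (gsrc x) by rewrite xs.
    rewrite !indic_in// mul1r mulr1 gV; [|exact: WV..].
    by rewrite indic_in// mulr1.
  case: (pselect (W (grng x))) => [rx|nrx]; last first.
    by rewrite (indic_out _ nrx) (indic_out _ nWx) mulr0 !mul0r.
  case: (pselect (W (gsrc x))) => [sx|nsx]; last first.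
    by rewrite (indic_out _ nsx) (indic_out _ nWx) !mulr0.
  rewrite gV; [|exact: WV..].
  have nx : ~ units G x by move=> xx; apply: nWx; rewrite -xx.
  by rewrite (indic_out _ nx) (indic_out _ nWx) !mulr0 mul0r.
exists W; split=> //; first by exists v.
have : I (fun x => k^-1 * (k * \1_W x)).
  by apply: IZ; rewrite -kW; apply: ideal_convr => //; exact: ideal_convl.
by apply: pred_eqfun => x; rewrite mulKf.
Qed.

(** Minimality gives an arrow [y] with range [u] and source in [W]. For a bisection [C] around [y]
    with sources in [W], the indicator of [C] is its own product with that of [W], hence in [I];
    multiplying by the inverse of [C] leaves the indicator of the range of [C]. *)
Lemma ideal_nbhs_unit W u : compact_bisection W -> W !=set0 ->
    W `<=` units G -> I \1_W -> units G u ->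
  exists N, [/\ compact_bisection N, N u, N `<=` units G & I \1_N].
Proof.
move=> cW [w Ww] WG IW uu; have [oW _ _ _] := cW.
have [_ /(_ (set_val @^-1` W))] := hmin uu; case.
- by exists (unit_rng w); rewrite /preimage/= val_unit_rng (WG _ Ww).
- by apply: open_comp => // x _; exact: initial_continuous.
move=> p [Wp [y yu yp]]; have Wy : W (gsrc y) by rewrite yp.
have [C [cC Cy CW]] :=
  compact_bisection_nbhs hample (open_src_preimage oW) Wy.
have [_ _ rC sC] := cC.
have IC : I \1_C.
  apply: (pred_eqfun _ (ideal_convl cC IW)) => x; rewrite conv_unitr//.
  case: (pselect (C x)) => [Cx|nCx]; last by rewrite indic_out// mul0r.
  by rewrite !indic_in ?mulr1//; exact: CW.
have cC' := compact_bisectionV cC.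
exists (setgmul C (@ginv G @^-1` C)); split.
- exact: compact_bisectionM.
- exists y, (ginv y); split=> //=; rewrite ?ginvK ?grng_ginv//.
  by rewrite gmulgV.
- move=> _ [a [b [Ca Cb ab ->]]].
  have -> : a = ginv b by apply: sC => //; rewrite gsrc_ginv.
  by rewrite gmulVg; exact: units_gsrc.
- by rewrite -conv_indic//; exact: ideal_convr.
Qed.

(** Induction on the cover: subtracting [conv \1_(N u) f], which is in [I], kills [f] over [N u] and
    leaves a function supported over the remaining sets. The sets [N u] may overlap. *)
Lemma ideal_cover (N : G -> set G) (s : seq G) :
    (forall u, u \in s ->
      [/\ compact_bisection (N u), N u `<=` units G & I \1_(N u)]) ->
  forall f, steinberg f ->
    (forall x, f x != 0 -> exists2 u, u \in s & N u (grng x)) -> I f.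
Proof.
case: hI => _ I0 ID _ IM.
elim: s => [_ f _ f0|u s IHs hN f sf fN].
  apply: (pred_eqfun _ I0) => x; have [//|/f0[]//] := eqVneq (f x) 0.
have [cN NG IN] : [/\ compact_bisection (N u), N u `<=` units G & I \1_(N u)].
  by apply: hN; rewrite mem_head.
have If : I (conv \1_(N u) f) by have [] := IM _ _ sf IN.
pose g := fun x => -1 * conv \1_(N u) f x + f x.
have Ig : I g.
  apply: IHs => [v vs||x gx]; first by apply: hN; rewrite in_cons vs orbT.
    by apply: steinberg_lin => //; exact: steinberg_conv_indicl.
  have nux : ~ N u (grng x).
    by move=> ux; move: gx; rewrite /g conv_unitl// indic_in// mul1r mulN1r
      addNr eqxx.
  move: gx; rewrite /g conv_unitl// indic_out// mul0r mulr0 add0r => /fN.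
  by move=> [v]; rewrite in_cons => /predU1P[->//|vs vx]; exists v.
apply: (pred_eqfun _ (ID _ _ If Ig)) => x.
by rewrite /g mulN1r addrA subrr add0r.
Qed.

Lemma ideal_trivial : I = [set (fun=> 0)] \/ I = @steinberg K G.
Proof.
have [IS I0 ID IZ _] := hI.
case: (pselect (exists2 f, I f & f <> (fun=> 0))) => [[f If f0]|nf]; last first.
  left; apply/seteqP; split=> [f If|_ ->//].
  by apply: contrapT => f0; apply: nf; exists f.
have [W [cW W0 WG IW]] := ideal_unit_indic If f0.
right; apply/seteqP; split=> //.
apply: (steinberg_ind hample) => // c B g cB _ Ig.
apply: (ID _ _ _ Ig); apply: IZ.
(* The implication sits under the existential so that [choice] yields a function on all of [G]; at a
   non-unit the empty set is a dummy value. *)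
have hN u : exists N, units G u ->
    [/\ compact_bisection N, N u, N `<=` units G & I \1_N].
  case: (pselect (units G u)) => [uu|nu]; last by exists set0.
  by have [N hN] := ideal_nbhs_unit cW W0 WG IW uu; exists N.
have [N {}hN] := choice hN.
have [_ kB _ _] := cB.
have [||D DG BD] := compact_finite_subset_cover
  (D := units G) (f := fun u => @grng G @^-1` N u) kB.
- by move=> u /hN[[oN _ _ _] _ _ _]; exact: open_rng_preimage.
- move=> x Bx; have xx := units_grng x; exists (grng x) => //.
  by have [] := hN _ xx.
apply: (@ideal_cover N D).
- by move=> u /DG /set_mem /hN[].
- exact: steinberg_indic.
- move=> x; case: (pselect (B x)) => [Bx _|nBx].
    by have [u uD ux] := BD _ Bx; exists u.
  by rewrite indic_out// eqxx.
Qed.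

End Simplicity.

Theorem theorem3p14 (K : fieldType) (G : topGroupoidType)
    (hsc : @second_countable G) (hample : ample G)
    (hT2 : hausdorff_space (units G)) :
  steinberg_simple K G <->
  [/\ minimal G,
      effective G &
      forall f : G -> K, steinberg f -> f <> (fun=> 0) ->
        (supp f)^° !=set0].
Proof.
split=> [S|[hmin heff hsupp] I hI]; last exact: ideal_trivial.
by split; [exact: simple_minimal S|exact: simple_effective S|exact: simple_supp].
Qed.
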